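(* Let $\Gamma = H \wr_X G$ be a finitely generated wreath product, where $H \neq 1$ and $X \neq \emptyset$, and let $M = \bigoplus_{x \in X} H_x \subseteq \Gamma$. Suppose that $$\Sigma^1(\Gamma) = \{[\chi] \in S(\Gamma) \mid \chi|_M \neq 0\}$$ and that the abelianization $G^{ab}$ of $G$ has torsion-free rank $1$. Then there is a subgroup of finite index $N \subseteq Aut(\Gamma)$ such that $R(\varphi) = \infty$ for all $\varphi \in N$.
   Context: Wreath product: given groups $H$, $G$ and a (left) $G$-set $X$, $H \wr_X G$ is the semidirect product $M \rtimes G$, where $M = \bigoplus_{x \in X} H_x$ is the restricted direct product of copies $H_x$ of $H$ indexed by $X$, and $G$ acts by permuting the copies according to its action on $X$. The groups $M$, $H_x$, $G$ are regarded as subgroups of $H \wr_X G$. Characters: for a finitely generated group $V$, a character is a homomorphism $\chi: V \to \mathbb{R}$ to the additive group of reals. The character sphere $S(V)$ is the set of non-zero characters modulo $\chi_1 \sim \chi_2$ iff $\chi_2 = r\chi_1$ for some real $r>0$; $[\chi]$ is the class of $\chi$. Put $V_\chi = \{v \in V \mid \chi(v) \geq 0\}$. Invariant $\Sigma^1$: for a finite generating set $\mathcal{X}$ of $V$, $Cay(V;\mathcal{X})$ is the Cayley graph with vertex set $V$, where $v_1, v_2$ are joined by an edge iff $v_2 = v_1 x$ for some $x \in \mathcal{X}^{\pm 1}$. $Cay(V;\mathcal{X})_\chi$ is the full subgraph spanned by $V_\chi$. Then $\Sigma^1(V) = \{[\chi] \in S(V) \mid Cay(V;\mathcal{X})_\chi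 \text{ is connected}\}$; this does not depend on the choice of $\mathcal{X}$. Reidemeister number: for an automorphism $\varphi$ of a group $V$, $R(\varphi)$ is the number of orbits of the twisted conjugacy action of $V$ on itself, $g \cdot h := g h \varphi(g^{-1})$ for $g,h \in V$. *)

(* Defs.v *)
From HB Require Import structures.
From mathcomp Require Import all_boot all_order all_algebra finmap generic_quotient.
From mathcomp Require Import boolp classical_sets cardinality reals.

Set Implicit Arguments.
Unset Strict Implicit.
Unset Printing Implicit Defensive.

Import Order.TTheory GRing.Theory Num.Theory.

Local Open Scope classical_set_scope.
Local Open Scope group_scope.

Section Subgroups.
Variable V : groupType.
Implicit Types P A N : set V.

Definition is_subgroup P : Prop :=
  P 1 /\ forall x y, P x -> P y -> P (x * y^-1).

Definition gen_by A : set V := smallest is_subgroup A.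

Definition generates (S : seq V) : Prop := gen_by [set` S] = setT.

Definition lcoset_of N (x : V) : set V := [set x * y | y in N].

Definition finite_index N : Prop :=
  finite_set [set lcoset_of N x | x in [set: V]].

Definition derived : set V :=
  gen_by [set z | exists x y : V, z = [~ x, y]].

Lemma gen_by_subgroup A : is_subgroup (gen_by A).
Proof.
split=> [P [[P1 _] _] //|x y Px Py P PA].
by case: (PA) => -[_ PM] _; apply: PM; [apply: Px|apply: Py].
Qed.

Lemma derived1 : derived 1.
Proof. by case: (gen_by_subgroup [set z | exists x y : V, z = [~ x, y]]). Qed.

Lemma derivedF x y : derived x -> derived y -> derived (x * y^-1).
Proof.
by case: (gen_by_subgroup [set z | exists x y : V, z = [~ x, y]]) => _; apply.
Qed.

Lemma derivedV x : derived x -> derived x^-1.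
Proof. by move=> Dx; rewrite -[x^-1]mul1g; apply: derivedF => //; apply: derived1. Qed.

Lemma derivedM x y : derived x -> derived y -> derived (x * y).
Proof. by move=> Dx Dy; rewrite -[y]invgK; apply: derivedF => //; apply: derivedV. Qed.

Lemma derivedR x y : derived [~ x, y].
Proof. by apply: sub_gen_smallest; exists x, y. Qed.

Lemma derivedJ x y : derived x -> derived (x ^ y).
Proof.
move=> Dx; rewrite -[x ^ y](mulKg x^-1) invgK.
by apply: derivedM => //; rewrite -/(commg x y); apply: derivedR.
Qed.

End Subgroups.

Section Abelianization.
Variable G : groupType.

Local Open Scope quotient_scope.

Definition ab_rel : rel G := [rel x y | x^-1 * y \in derived (V := G)].

Lemma ab_relP x y : reflect (derived (x^-1 * y)) (ab_rel x y).
Proof. by apply: (iffP idP); rewrite inE. Qed.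

Fact ab_rel_refl : reflexive ab_rel.
Proof. by move=> x; apply/ab_relP; rewrite mulVg; apply: derived1. Qed.

Fact ab_rel_sym : symmetric ab_rel.
Proof.
by move=> x y; apply/ab_relP/ab_relP => /derivedV; rewrite invgM invgK.
Qed.

Fact ab_rel_trans : transitive ab_rel.
Proof.
move=> y x z /ab_relP Dxy /ab_relP Dyz; apply/ab_relP.
by have := derivedM Dxy Dyz; rewrite mulgA mulgK.
Qed.

Canonical ab_equiv := EquivRel ab_rel ab_rel_refl ab_rel_sym ab_rel_trans.

Definition abelianization : Type := {eq_quot ab_equiv}.

HB.instance Definition _ := Choice.on abelianization.

Definition ab_pi (x : G) : abelianization := \pi_{eq_quot ab_equiv} x.
Definition ab_repr (a : abelianization) : G :=
  repr (a : {eq_quot ab_equiv}).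

Lemma ab_reprK : cancel ab_repr ab_pi.
Proof. by move=> a; rewrite /ab_pi /ab_repr reprK. Qed.

Lemma eq_ab_pi x y : ab_pi x = ab_pi y <-> derived (x^-1 * y).
Proof.
split=> [/eqmodP /ab_relP //|D].
by apply/eqmodP; apply/ab_relP.
Qed.

Lemma ab_repr_pi x : derived (x^-1 * ab_repr (ab_pi x)).
Proof. by apply/eq_ab_pi; rewrite ab_reprK. Qed.

Definition ab_zero : abelianization := ab_pi 1.
Definition ab_opp (a : abelianization) : abelianization :=
  ab_pi (ab_repr a)^-1.
Definition ab_add (a b : abelianization) : abelianization :=
  ab_pi (ab_repr a * ab_repr b).

Lemma ab_addE x y : ab_add (ab_pi x) (ab_pi y) = ab_pi (x * y).
Proof.
apply/esym/eq_ab_pi; rewrite invgM.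
set x' := ab_repr _; set y' := ab_repr _.
have -> : y^-1 * x^-1 * (x' * y') = (x^-1 * x') ^ y * (y^-1 * y').
  by rewrite /conjg !mulgA mulgK.
by apply: derivedM; [apply: derivedJ|]; apply: ab_repr_pi.
Qed.

Lemma ab_oppE x : ab_opp (ab_pi x) = ab_pi x^-1.
Proof.
apply/eq_ab_pi; rewrite invgK.
have := derivedJ x^-1 (ab_repr_pi x).
by rewrite /conjg invgK !mulgA mulgV mul1g.
Qed.

Fact ab_addA : associative ab_add.
Proof.
move=> a b c; rewrite -[a]ab_reprK -[b]ab_reprK -[c]ab_reprK.
by rewrite !ab_addE mulgA.
Qed.

Fact ab_addC : commutative ab_add.
Proof.
move=> a b; rewrite -[a]ab_reprK -[b]ab_reprK !ab_addE.
set x := ab_repr a; set y := ab_repr b.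
apply/eq_ab_pi; have := derivedR y x.
by rewrite /commg /conjg invgM !mulgA.
Qed.

Fact ab_add0 : left_id ab_zero ab_add.
Proof. by move=> a; rewrite -[a]ab_reprK ab_addE mul1g. Qed.

Fact ab_addN : left_inverse ab_zero ab_opp ab_add.
Proof. by move=> a; rewrite -[a]ab_reprK ab_oppE ab_addE mulVg. Qed.

HB.instance Definition _ := GRing.isZmodule.Build abelianization
  ab_addA ab_addC ab_add0 ab_addN.

End Abelianization.

Section TorsionFreeRank.
Variable A : zmodType.

Definition Z_independent n (a : 'I_n -> A) : Prop :=
  forall k : 'I_n -> int,
    (\sum_(i < n) a i *~ k i = 0)%R -> forall i, k i = 0%R.

Definition torsion_free_rank_eq (n : nat) : Prop :=
  (exists a : 'I_n -> A, Z_independent a) /\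
  ~ (exists a : 'I_n.+1 -> A, Z_independent a).

End TorsionFreeRank.

Record gset (G : groupType) (X : Type) := GSet {
  gact :> G -> X -> X;
  gact1 : forall x, gact 1 x = x;
  gactM : forall g h x, gact (g * h) x = gact g (gact h x)
}.

Section WreathProduct.
Variables (H G : groupType) (X : choiceType) (act : gset G X).

Definition restricted_prod : Type := {fsfun X -> H with 1}.
HB.instance Definition _ := Choice.on restricted_prod.

Implicit Types m : restricted_prod.

Definition rp_one : restricted_prod := [fsfun with 1].
Definition rp_mul m1 m2 : restricted_prod :=
  [fsfun x in (finsupp m1 `|` finsupp m2)%fset => m1 x * m2 x].
Definition rp_inv m : restricted_prod :=
  [fsfun x in finsupp m => (m x)^-1].
Definition rp_act (g : G) m : restricted_prod :=
  [fsfun x in [fset act g y | y in finsupp m]%fset => m (act g^-1 x)].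

Lemma rp_oneE x : rp_one x = 1.
Proof. by rewrite /rp_one fsfun_dflt // finsupp0. Qed.

Lemma rp_mulE m1 m2 x : rp_mul m1 m2 x = m1 x * m2 x.
Proof.
rewrite fsfunE; case: ifPn => //; rewrite inE negb_or => /andP[n1 n2].
by rewrite !fsfun_dflt // mulg1.
Qed.

Lemma rp_invE m x : rp_inv m x = (m x)^-1.
Proof. by rewrite fsfunE; case: ifPn => // n1; rewrite fsfun_dflt // invg1. Qed.

Lemma rp_actE g m x : rp_act g m x = m (act g^-1 x).
Proof.
rewrite fsfunE; case: ifPn => // /imfsetP nx; apply/esym/fsfun_dflt.
apply/negP => mx; apply: nx; exists (act g^-1 x) => //=.
by rewrite -gactM mulgV gact1.
Qed.

(* The phantom parameter makes the type, hence the inferred group law, depend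
   on the action. *)
Record wreath (a : gset G X) : Type :=
  Wreath { wbase : restricted_prod; wtop : G }.
Local Notation wr := (wreath act).

Definition wreath_pair (w : wr) := (wbase w, wtop w).
Definition pair_wreath p : wr := Wreath act p.1 p.2.
Lemma wreath_pairK : cancel wreath_pair pair_wreath.
Proof. by case. Qed.
HB.instance Definition _ := Choice.copy wr (can_type wreath_pairK).

(* [(m1, g1) (m2, g2) = (m1 . g1(m2), g1 g2)], where [g] maps the copy [H_x]
   identically onto the copy [H_(g x)]; whence the [g^-1] in [rp_act]. *)
Definition wr_one : wr := Wreath act rp_one 1.
Definition wr_mul (w1 w2 : wr) : wr :=
  Wreath act (rp_mul (wbase w1) (rp_act (wtop w1) (wbase w2)))
         (wtop w1 * wtop w2).
Definition wr_inv (w : wr) : wr :=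
  Wreath act (rp_act (wtop w)^-1 (rp_inv (wbase w))) (wtop w)^-1.

Lemma wreath_eq (w1 w2 : wr) :
  (forall x, wbase w1 x = wbase w2 x) -> wtop w1 = wtop w2 -> w1 = w2.
Proof. by case: w1 w2 => [m1 g1] [m2 g2] /= /fsfunP -> ->. Qed.

Fact wr_mulA : associative wr_mul.
Proof.
move=> u v w; apply: wreath_eq => [x|] /=; last exact: mulgA.
by rewrite !(rp_mulE, rp_actE) invgM gactM mulgA.
Qed.

Fact wr_mul1 : left_id wr_one wr_mul.
Proof.
move=> w; apply: wreath_eq => [x|] /=; last exact: mul1g.
by rewrite !(rp_mulE, rp_actE) rp_oneE invg1 gact1 mul1g.
Qed.

Fact wr_mulr1 : right_id wr_one wr_mul.
Proof.
move=> w; apply: wreath_eq => [x|] /=; last exact: mulg1.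
by rewrite !(rp_mulE, rp_actE) rp_oneE mulg1.
Qed.

Fact wr_mulV : left_inverse wr_one wr_inv wr_mul.
Proof.
move=> w; apply: wreath_eq => [x|] /=; last exact: mulVg.
by rewrite !(rp_mulE, rp_actE, rp_invE) rp_oneE invgK mulVg.
Qed.

Fact wr_mulrV : right_inverse wr_one wr_inv wr_mul.
Proof.
move=> w; apply: wreath_eq => [x|] /=; last exact: mulgV.
by rewrite !(rp_mulE, rp_actE, rp_invE) rp_oneE invgK -gactM mulgV gact1 mulgV.
Qed.

HB.instance Definition _ := isGroup.Build wr
  wr_mulA wr_mul1 wr_mulr1 wr_mulV wr_mulrV.

Definition base_subgroup : set wr := [set Wreath act m 1 | m in setT].

End WreathProduct.

Arguments wreath H {G X} a.
Arguments base_subgroup H {G X} act.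

Section Sigma1.
Variables (R : realType) (V : groupType).
Implicit Types chi : V -> R.

Local Open Scope ring_scope.

Definition is_character chi : Prop :=
  forall v w : V, chi (v * w)%g = chi v + chi w.

Definition nonzero_character chi : Prop :=
  is_character chi /\ exists v, chi v != 0.

(* A point of the character sphere is represented by its equivalence class,
   an open ray of characters. *)
Definition char_class chi : set (V -> R) :=
  [set psi | exists2 r : R, 0 < r & psi = (fun v => r * chi v)].

(* [{[chi] in S(V) | P chi}] *)
Definition character_sphere_where (P : set (V -> R)) : set (set (V -> R)) :=
  [set char_class chi | chi in nonzero_character `&` P].

Definition cayley_adj (S : seq V) : rel V :=
  fun v1 v2 => has (fun x => (v2 == v1 * x)%g || (v2 == v1 * x^-1)%g) S.

(* Connectedness of the full subgraph of the graph [e] spanned by [A]. *)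
Definition spanned_connected (e : rel V) (A : set V) : Prop :=
  forall v w, A v -> A w ->
    exists p : seq V, [/\ path e v p, last v p = w & {in p, forall u, A u}].

Definition half_space chi : set V := [set v | 0 <= chi v].

(* Independent of [S], as long as [S] generates [V]. *)
Definition Sigma1 (S : seq V) : set (set (V -> R)) :=
  character_sphere_where
    [set chi | spanned_connected (cayley_adj S) (half_space chi)].

End Sigma1.

Arguments Sigma1 R {V} S.

Section Automorphisms.
Variable V : groupType.

Record aut := Aut {
  aut_fun :> V -> V;
  aut_inv_fun : V -> V;
  aut_morph : {morph aut_fun : x y / x * y};
  aut_funK : cancel aut_fun aut_inv_fun;
  aut_invK : cancel aut_inv_fun aut_fun
}.

HB.instance Definition _ := gen_eqMixin aut.
HB.instance Definition _ := gen_choiceMixin aut.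

Lemma aut_eq (f g : aut) : f =1 g -> f = g.
Proof.
case: f g => [f f' fM fK f'K] [g g' gM gK g'K] /= /funext fg.
case: _ / fg in gM gK g'K *.
have fg' : f' = g' by apply/funext => x; rewrite -[in RHS](f'K x) gK.
case: _ / fg' in gK g'K *.
by congr Aut; apply: Prop_irrelevance.
Qed.

Definition aut_one : aut := @Aut idfun idfun (fun _ _ => erefl)
  (fun _ => erefl) (fun _ => erefl).

Fact aut_mul_morph (f g : aut) : {morph f \o g : x y / x * y}.
Proof. by move=> x y; rewrite /= !aut_morph. Qed.

Definition aut_mul (f g : aut) : aut := Aut (aut_mul_morph f g)
  (can_comp (aut_funK f) (aut_funK g)) (can_comp (aut_invK g) (aut_invK f)).

Fact aut_inv_morph (f : aut) : {morph aut_inv_fun f : x y / x * y}.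
Proof.
by move=> x y; apply: (can_inj (aut_funK f)); rewrite aut_morph !aut_invK.
Qed.

Definition aut_inv (f : aut) : aut :=
  Aut (aut_inv_morph f) (aut_invK f) (aut_funK f).

Fact aut_mulA : associative aut_mul.
Proof. by move=> f g h; apply: aut_eq. Qed.
Fact aut_mul1 : left_id aut_one aut_mul.
Proof. by move=> f; apply: aut_eq. Qed.
Fact aut_mulr1 : right_id aut_one aut_mul.
Proof. by move=> f; apply: aut_eq. Qed.
Fact aut_mulV : left_inverse aut_one aut_inv aut_mul.
Proof. by move=> f; apply: aut_eq => x /=; rewrite aut_funK. Qed.
Fact aut_mulrV : right_inverse aut_one aut_inv aut_mul.
Proof. by move=> f; apply: aut_eq => x /=; rewrite aut_invK. Qed.

HB.instance Definition _ := isGroup.Build aut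
  aut_mulA aut_mul1 aut_mulr1 aut_mulV aut_mulrV.

Definition twisted_orbit (phi : aut) (h : V) : set V :=
  [set g * h * phi g^-1 | g in [set: V]].

Definition reidemeister_classes (phi : aut) : set (set V) :=
  [set twisted_orbit phi h | h in [set: V]].

Definition reidemeister_infinite (phi : aut) : Prop :=
  infinite_set (reidemeister_classes phi).

End Automorphisms.

(* Main.v *)
Require Import Defs.
From HB Require Import structures.
From mathcomp Require Import all_boot all_order all_algebra.
From mathcomp Require Import lra.
From mathcomp Require Import boolp classical_sets cardinality reals.

Set Implicit Arguments.
Unset Strict Implicit.
Unset Printing Implicit Defensive.

Local Open Scope classical_set_scope.
Local Open Scope ring_scope.

Import Order.TTheory GRing.Theory Num.Theory.

(** Write [M] for the base subgroup.  Since [G^ab] has rank one and [Gamma] is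
    finitely generated, the characters of [Gamma] that vanish on [M], which are
    those factoring through [G], form a line spanned by a character [chi] with
    values in the integers ([wreath_rank1_character]).

    The set [Sigma^1] does not depend on the generating set
    ([spanned_connected_generators]), hence it is invariant under [Aut(Gamma)],
    and so is its complement.  The hypothesis on [Sigma^1] says that this
    complement consists of the classes of the characters that vanish on [M]:
    thus [chi o phi] vanishes on [M] for every automorphism [phi]
    ([character_aut_vanishes]), and [chi o phi = r chi] for a real [r].  As
    [chi] and [chi o phi] have the same image, a nonzero subgroup of the
    integers, [r] is [1] or [-1] ([proportional_aut_sign]).

    The stabilizer [N] of [chi] in [Aut(Gamma)] therefore has index at most two.
    If [phi] is in [N], then [chi (g * h * phi g^-1) = chi h], so [chi] is
    constant on twisted conjugacy classes; its image being infinite, there are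
    infinitely many classes ([reidemeister_infinite_fixed_character]). *)

(** * Generating sets and homomorphisms to abelian groups *)

Lemma generates_ind (V : groupType) (S : seq V) (P : set V) :
  generates S -> is_subgroup P -> (forall s, s \in S -> P s) ->
  forall v, P v.
Proof.
move=> gS Psub PS v; have : gen_by [set` S] v by rewrite gS.
by apply; split=> // s; apply: PS.
Qed.

Section Additive.
Variables (V : groupType) (U : zmodType) (f : V -> U).
Hypothesis fM : {morph f : x y / (x * y)%g >-> x + y}.

Lemma additive1 : f 1%g = 0.
Proof. by apply: (addrI (f 1%g)); rewrite -fM mulg1 addr0. Qed.

Lemma additiveV x : f x^-1%g = - f x.
Proof. by apply/eqP; rewrite -addr_eq0 -fM mulVg additive1. Qed.

Lemma additiveX x n : f (x ^+ n)%g = f x *+ n.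
Proof.
elim: n => [|n IHn]; first by rewrite expg0 additive1.
by rewrite expgS fM IHn mulrS.
Qed.

Lemma additive_kernel_subgroup : is_subgroup [set x | f x = 0].
Proof.
split=> [|x y /= fx fy]; first exact: additive1.
by rewrite fM additiveV fx fy subr0.
Qed.

Lemma additive_derived x : derived x -> f x = 0.
Proof.
move=> Dx; apply: (Dx [set x | f x = 0]).
split=> [|_ [y [z ->]]] /=; first exact: additive_kernel_subgroup.
rewrite /commg /conjg !fM !additiveV.
by rewrite (addrC (f y)) addKr addNr.
Qed.

Lemma additive_neq0_generator (S : seq V) :
  generates S -> (exists v, f v != 0) -> exists2 s, s \in S & f s != 0.
Proof.
move=> gS [v /eqP fv]; apply: contrapT => noS; apply: fv.
apply: (generates_ind gS additive_kernel_subgroup) => s sS /=.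
by apply: contrapT => /eqP fs; apply: noS; exists s.
Qed.

End Additive.

Lemma aut1 (V : groupType) (phi : aut V) : phi 1%g = 1%g.
Proof. by apply: (mulgI (phi 1%g)); rewrite -aut_morph !mulg1. Qed.

Lemma autV (V : groupType) (phi : aut V) x : phi x^-1%g = (phi x)^-1%g.
Proof. by apply: (mulgI (phi x)); rewrite -aut_morph !mulgV aut1. Qed.

Section AdditiveAbelianization.
Variables (G : groupType) (U : zmodType) (f : G -> U).
Hypothesis fM : {morph f : x y / (x * y)%g >-> x + y}.

Definition ab_lift (a : abelianization G) : U := f (ab_repr a).

(** Any representative of a class computes the induced map, because [f] kills
    commutators. *)
Lemma ab_lift_pi g : ab_lift (ab_pi g) = f g.
Proof.
have /(additive_derived fM) := ab_repr_pi g.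
by rewrite fM (additiveV fM) addrC => /eqP; rewrite subr_eq0 => /eqP.
Qed.

Lemma ab_liftMz a n : ab_lift (a *~ n) = ab_lift a *~ n.
Proof.
have liftD : {morph ab_lift : b c / b + c}.
  by move=> b c; rewrite ab_lift_pi fM.
have lift0 : ab_lift 0 = 0 by rewrite ab_lift_pi additive1.
have liftMn b m : ab_lift (b *+ m) = ab_lift b *+ m.
  by elim: m => [//|m IHm]; rewrite !mulrS liftD IHm.
case: n => m; first by rewrite -!pmulrn liftMn.
rewrite NegzE !mulrNz -!pmulrn; apply/eqP.
by rewrite -addr_eq0 -liftMn -liftD addNr lift0.
Qed.

End AdditiveAbelianization.

Lemma ab_piM (G : groupType) :
  {morph @ab_pi G : x y / (x * y)%g >-> x + y}.
Proof. by move=> x y; rewrite -ab_addE. Qed.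

(** * Connectivity in Cayley graphs *)

Section Linked.
Variables (T : eqType) (e : rel T).
Hypothesis e_sym : symmetric e.

(** Unlike in [spanned_connected], the starting point is required to lie in
    [A]; this makes the relation symmetric. *)
Definition linked (A : set T) (v w : T) : Prop :=
  exists p, [/\ path e v p, last v p = w & {in v :: p, forall u, A u}].

Lemma linked_refl (A : set T) v : A v -> linked A v v.
Proof. by move=> Av; exists [::]; split=> // u; rewrite inE => /eqP->. Qed.

Lemma linked_step (A : set T) v w : A v -> A w -> e v w -> linked A v w.
Proof.
move=> Av Aw evw; exists [:: w]; split=> //=; first by rewrite evw.
by move=> u; rewrite !inE => /orP[] /eqP->.
Qed.

Lemma linked_trans (A : set T) u v w :
  linked A u v -> linked A v w -> linked A u w.
Proof.
move=> [p [ep <- Ap]] [q [eq <- Aq]]; exists (p ++ q); split.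
- by rewrite cat_path ep.
- by rewrite last_cat.
- move=> x; rewrite -cat_cons mem_cat => /orP[/Ap//|xq].
  by apply: Aq; rewrite inE xq orbT.
Qed.

Lemma linked_sym (A : set T) v w : linked A v w -> linked A w v.
Proof.
move=> [p [ep <- Ap]]; exists (rev (belast v p)); split.
- by rewrite rev_path; under eq_path => ? ? do rewrite e_sym.
- by case: p {ep Ap} => //= x p; rewrite rev_cons last_rcons.
- by move=> u; rewrite -rev_rcons -lastI mem_rev; apply: Ap.
Qed.

Lemma linked_sub (A B : set T) v w : A `<=` B -> linked A v w -> linked B v w.
Proof. by move=> AB [p [ep vw Ap]]; exists p; split=> // u /Ap /AB. Qed.

End Linked.

Lemma spanned_connectedP (V : groupType) (e : rel V) (A : set V) :
  (forall v w, A v -> A w -> linked e A v w) <-> spanned_connected e A.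
Proof.
split=> conn v w Av Aw; have [p [ep vw Ap]] := conn v w Av Aw; exists p.
  by split=> // u up; apply: Ap; rewrite inE up orbT.
by split=> // u; rewrite inE => /orP[/eqP->//|/Ap].
Qed.

(** An edge may be sent to a path: this is what allows one generating set to be
    traded for another. *)
Lemma linked_map (T1 T2 : eqType) (e1 : rel T1) (e2 : rel T2) (h : T1 -> T2)
    (A1 : set T1) (A2 : set T2) v w :
  (forall x y, e1 x y -> A1 x -> A1 y -> linked e2 A2 (h x) (h y)) ->
  (forall x, A1 x -> A2 (h x)) ->
  linked e1 A1 v w -> linked e2 A2 (h v) (h w).
Proof.
move=> hstep hA [p [ep <- Ap]].
elim: p v ep Ap => [|x p IHp] v /=.
  by move=> _ Ap; apply/linked_refl/hA/Ap; rewrite inE.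
move=> /andP[evx ep] Ap.
have Apx : {in x :: p, forall u, A1 u}.
  by move=> u up; apply: Ap; rewrite inE up orbT.
apply: linked_trans (IHp x ep Apx).
by apply: hstep => //; [apply: Ap|apply: Apx]; rewrite inE eqxx.
Qed.

Section Cayley.
Variables (R : realType) (V : groupType) (S : seq V).

Lemma cayley_adj_sym : symmetric (cayley_adj S).
Proof.
suff sub v w : cayley_adj S v w -> cayley_adj S w v.
  by move=> v w; apply/idP/idP; apply: sub.
move=> /hasP[x xS vw]; apply/hasP; exists x => //.
by case/orP: vw => /eqP->; rewrite ?mulgK ?mulgVK eqxx ?orbT.
Qed.

Lemma cayley_adjM (u v w : V) :
  cayley_adj S v w -> cayley_adj S (u * v)%g (u * w)%g.
Proof.
move=> /hasP[x xS vw]; apply/hasP; exists x => //.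
by case/orP: vw => /eqP->; rewrite mulgA eqxx ?orbT.
Qed.

Lemma cayley_adj_gen s v : s \in S -> cayley_adj S v (v * s)%g.
Proof. by move=> sS; apply/hasP; exists s; rewrite ?eqxx. Qed.

Variable chi : V -> R.
Hypothesis chiM : is_character chi.

Definition above (c : R) : set V := [set v | c <= chi v].

(** Right multiplication by [x] can be followed along a path reading a fixed
    word for [x]; left translates of that path descend by the same amount below
    their starting points. *)
Lemma bounded_descent x : generates S ->
  exists2 d : R, 0 <= d &
    forall v, linked (cayley_adj S) (above (chi v - d)) v (v * x)%g.
Proof.
move=> gS; pose P x := exists2 d : R, 0 <= d &
    forall v, linked (cayley_adj S) (above (chi v - d)) v (v * x)%g.
apply: (generates_ind (P := P) gS) => {x} [|s sS].
- split.
    exists 0 => // v; rewrite mulg1; apply: linked_refl.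
    by rewrite /above /= subr0.
  move=> x y [d d0 dP] [c c0 cP].
  (* The path for [y^-1] is that for [y], started at [v * x * y^-1] and run
     backwards; the norms make up for the height of its new origin. *)
  exists (d + c + `|chi x| + `|chi y|); first by rewrite !addr_ge0.
  move=> v; apply: (linked_trans (v := (v * x)%g)).
    apply: linked_sub (dP v) => u; apply: le_trans.
    by rewrite lerD2l lerN2 -!addrA lerDl !addr_ge0.
  apply: linked_sym; first exact: cayley_adj_sym.
  have := cP (v * (x * y^-1))%g; rewrite -!mulgA mulVg mulg1.
  apply: linked_sub => u; apply: le_trans.
  rewrite !chiM (additiveV chiM) -!addrA lerD2l.
  have := ler_norm (chi y); have := lerNnormlW (lexx `|chi x|); lra.
- exists `|chi s| => // v; apply: linked_step.
  + by rewrite /above /= gerBl.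
  + rewrite /above /= chiM lerD2l; exact: lerNnormlW.
  + exact: cayley_adj_gen.
Qed.

Lemma bounded_descent_seq (T : seq V) : generates S ->
  exists2 d : R, 0 <= d & forall x, x \in T ->
    forall v, linked (cayley_adj S) (above (chi v - d)) v (v * x)%g.
Proof.
move=> gS; elim: T => [|x T [d d0 dP]]; first by exists 0.
have [c c0 cP] := bounded_descent x gS.
exists (d + c) => [|y]; first exact: addr_ge0.
rewrite inE => /orP[/eqP->|yT] v.
  apply: linked_sub (cP v) => u; apply: le_trans.
  by rewrite lerD2l lerN2 lerDr.
apply: linked_sub (dP y yT v) => u; apply: le_trans.
by rewrite lerD2l lerN2 lerDl.
Qed.

(** Independence of [Sigma^1] from the generating set.  Pick [t], a generator or
    the inverse of one, with [chi t > 0].  Two points [v], [w] of the half space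
    are climbed out of to [v t^n] and [w t^n], which lie at height at least [d];
    these are joined by a [T]-path that stays above level [d], namely the
    translate by [t^n] of a [T]-path inside the half space.  Replacing each of
    its edges by an [S]-path descending by at most [d] keeps it in the half
    space. *)
Lemma spanned_connected_generators (T : seq V) :
  generates S -> (exists v, chi v != 0) ->
  spanned_connected (cayley_adj T) (half_space chi) ->
  spanned_connected (cayley_adj S) (half_space chi).
Proof.
move=> gS chi_neq0 /spanned_connectedP connT; apply/spanned_connectedP.
have [d d0 dP] := bounded_descent_seq T gS.
have [t chit tS] : exists2 t, 0 < chi t & forall v, cayley_adj S v (v * t)%g.
  have [s sS] := additive_neq0_generator chiM gS chi_neq0.
  rewrite neq_lt => /orP[chis|chis]; last first.
    by exists s => // v; apply: cayley_adj_gen.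
  exists s^-1%g => [|v]; first by rewrite (additiveV chiM) oppr_gt0.
  by apply/hasP; exists s => //; rewrite eqxx orbT.
have [n dn] : exists n, d <= chi t *+ n.
  have [n dn] : exists n : nat, d / chi t < n%:R.
    exists (Num.bound (d / chi t)); apply: archi_boundP.
    by rewrite divr_ge0 // ltW.
  exists n; rewrite -mulr_natr mulrC -ler_pdivrMr //; exact: ltW.
have climb v m : 0 <= chi v ->
    linked (cayley_adj S) (half_space chi) v (v * t ^+ m)%g.
  move=> v0; have up k : half_space chi (v * t ^+ k)%g.
    rewrite /half_space /= chiM (additiveX chiM).
    by rewrite addr_ge0 // mulrn_wge0 // ltW.
  elim: m => [|m IHm]; first by rewrite expg0 mulg1; apply: linked_refl.
  apply: linked_trans IHm _; apply: linked_step => //.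
  by rewrite expgSr mulgA.
move=> v w v0 w0.
pose tn := (t ^+ n)%g.
have chi_tn : d <= chi tn by rewrite (additiveX chiM).
apply: linked_trans (climb v n v0) _.
apply: (linked_trans (v := (w * tn)%g)); last first.
  by apply: linked_sym (climb w n w0); apply: cayley_adj_sym.
(* Conjugating by [t^-n] preserves heights, so the two points below are again in
   the half space; translating by [t^n] sends them to [v t^n] and [w t^n]. *)
have := connT (tn^-1 * (v * tn))%g (tn^-1 * (w * tn))%g.
rewrite /half_space /= !chiM (additiveV chiM) ![- _ + _]addrC !addrK.
move=> /(_ v0 w0) /(linked_map (h := (fun u => (tn * u)%g))).
rewrite !mulVKg; apply=> [x y|x] /=; last first.
  by move=> x0; rewrite chiM addr_ge0 // (le_trans d0).
move=> /hasP[z zT xy] x0 y0.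
have step u : 0 <= chi u ->
    linked (cayley_adj S) (half_space chi) (tn * u)%g (tn * (u * z))%g.
  move=> u0; rewrite mulgA; apply: linked_sub (dP z zT _) => u'.
  by apply: le_trans; rewrite chiM addrAC addr_ge0 // subr_ge0.
case/orP: xy => /eqP yE; first by rewrite yE; apply: step.
have -> : x = (y * z)%g by rewrite yE mulgVK.
by apply: linked_sym; [apply: cayley_adj_sym|apply: step].
Qed.

End Cayley.

(** An automorphism [phi] is an isomorphism from the Cayley graph of [S] to that
    of [phi S], under which [chi o phi] corresponds to [chi]. *)
Lemma spanned_connected_aut (R : realType) (V : groupType) (S : seq V)
    (phi : aut V) (chi : V -> R) :
  spanned_connected (cayley_adj S) (half_space (chi \o phi)) ->
  spanned_connected (cayley_adj (map phi S)) (half_space chi).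
Proof.
move=> /spanned_connectedP conn; apply/spanned_connectedP => v w v0 w0.
have := conn (aut_inv_fun phi v) (aut_inv_fun phi w).
rewrite /half_space /= !aut_invK => /(_ v0 w0).
move=> /(linked_map (h := phi)); rewrite !aut_invK; apply=> // x y.
move=> /hasP[s sS xy] x0 y0; apply: linked_step => //.
apply/hasP; exists (phi s); first exact: map_f.
by case/orP: xy => /eqP->; rewrite aut_morph ?autV eqxx ?orbT.
Qed.

(** * The invariant as a set of characters *)

(** Membership of a class in a subset of the sphere may be tested on any
    representative, provided that the defining condition is stable under
    positive scaling. *)
Lemma char_classP (R : realType) (V : groupType) (P : set (V -> R)) chi :
  nonzero_character chi ->
  (forall (r : R) psi, 0 < r -> P psi -> P (fun v => r * psi v)) ->
  character_sphere_where P (char_class chi) <-> P chi.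
Proof.
move=> chi_nz Pscale; split=> [[psi [_ Ppsi] cl]|Pchi]; last by exists chi.
have : char_class chi chi.
  by exists 1 => //; apply/funext => v; rewrite mul1r.
by rewrite -cl => -[r r0 ->]; apply: Pscale.
Qed.

Lemma spanned_connectedZ (R : realType) (V : groupType) (S : seq V)
    (chi : V -> R) (r : R) : 0 < r ->
  spanned_connected (cayley_adj S) (half_space (fun v => r * chi v)) <->
  spanned_connected (cayley_adj S) (half_space chi).
Proof.
move=> r0; have -> // : half_space (fun v => r * chi v) = half_space chi.
by apply/seteqP; split=> v; rewrite /half_space /= pmulr_rge0.
Qed.

Section SigmaComplement.
Variables (R : realType) (V : groupType) (S : seq V) (B : set V).
Hypothesis gS : generates S.
Hypothesis sigmaE : Sigma1 R S =
  character_sphere_where [set chi | exists2 v, B v & chi v != 0].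

Lemma Sigma1_connected (chi : V -> R) : nonzero_character chi ->
  (exists2 v, B v & chi v != 0) <->
  spanned_connected (cayley_adj S) (half_space chi).
Proof.
move=> chi_nz; split=> [chiB|conn].
- apply: (iffLR (char_classP (P := fun psi =>
    spanned_connected (cayley_adj S) (half_space psi)) chi_nz _)).
    by move=> r psi r0 /(spanned_connectedZ _ _ r0).
  by rewrite -[character_sphere_where _]/(Sigma1 R S) sigmaE; exists chi.
- apply: (iffLR (char_classP (P := fun psi : V -> R =>
    exists2 v, B v & psi v != 0) chi_nz _)).
    by move=> r psi r0 [v Bv psiv]; exists v; rewrite // mulf_neq0 // gt_eqF.
  by rewrite -[character_sphere_where _]sigmaE; exists chi.
Qed.

(** Otherwise the class of [chi o phi] lies in [Sigma^1], hence so does that of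
    [chi] by invariance, although [chi] vanishes on [B]. *)
Lemma character_aut_vanishes (chi : V -> R) (phi : aut V) :
  nonzero_character chi -> (forall v, B v -> chi v = 0) ->
  forall v, B v -> chi (phi v) = 0.
Proof.
move=> chi_nz chiB v Bv; apply: contrapT => /eqP chiphiv.
have [chiM chi_neq0] := chi_nz.
have : spanned_connected (cayley_adj S) (half_space (chi \o phi)).
  apply/Sigma1_connected; last by exists v.
  split; last by exists v.
  by move=> x y; rewrite /= aut_morph chiM.
move=> /spanned_connected_aut.
move=> /(spanned_connected_generators chiM gS chi_neq0).
by move=> /(Sigma1_connected chi_nz)[w Bw]; rewrite chiB ?eqxx.
Qed.

End SigmaComplement.

(** * Automorphisms and integral characters *)

Section IntegralCharacter.
Variables (V : groupType) (chi : V -> int).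
Hypothesis chiM : {morph chi : x y / (x * y)%g >-> x + y}.
Hypothesis chi_neq0 : exists v, chi v != 0.

(** A fixed character is constant on twisted conjugacy classes, so the powers of
    an element outside its kernel lie in pairwise distinct classes. *)
Lemma reidemeister_infinite_fixed_character (phi : aut V) :
  (forall v, chi (phi v) = chi v) -> reidemeister_infinite phi.
Proof.
move=> chiphi fin; have [v chiv] := chi_neq0; apply: infinite_nat.
have orbit_chi h w : twisted_orbit phi h w -> chi w = chi h.
  by move=> [g _ <-]; rewrite !chiM chiphi (additiveV chiM) addrAC addrN add0r.
have orbit_refl h : twisted_orbit phi h h.
  exists 1%g => //.
  by rewrite invg1 mul1g aut1 mulg1.
pose cl n := twisted_orbit phi (v ^+ n)%g.
have cl_inj : injective cl.
  move=> m n clmn; have := orbit_refl (v ^+ m)%g.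
  rewrite -/(cl m) clmn => /orbit_chi.
  by rewrite !(additiveX chiM); apply: mulrIn.
suff <- : cl @^-1` reidemeister_classes phi = setT.
  by apply: finite_preimage fin => m n _ _; apply: cl_inj.
by apply/seteqP; split=> // n _; exists (v ^+ n)%g.
Qed.

(** Compare heights at [v], where the nonzero value of [chi] has least norm: the
    values at [phi v] and at [phi^-1 v] force [|r| >= 1] and [|r^-1| >= 1]. *)
Lemma proportional_aut_sign (R : realType) (phi : aut V) (r : R) :
  (forall v, (chi (phi v))%:~R = r * (chi v)%:~R) ->
  r = 1 \/ r = -1.
Proof.
move=> rE.
have [m [v [chiv chi_m]] m_min] : exists2 m : nat,
    exists v, chi v != 0 /\ `|chi v|%N = m &
    forall w, chi w != 0 -> (m <= `|chi w|)%N.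
  have exP : exists n : nat, `[< exists v, chi v != 0 /\ `|chi v|%N = n >].
    by have [v chiv] := chi_neq0; exists `|chi v|%N; apply/asboolP; exists v.
  case: (ex_minnP exP) => m /asboolP mP m_min; exists m => // w chiw.
  by apply: m_min; apply/asboolP; exists w.
have r_neq0 : r != 0.
  apply: contra_neq chiv => r0; have := rE (aut_inv_fun phi v).
  by rewrite aut_invK r0 mul0r => /eqP; rewrite intr_eq0 => /eqP.
have min_norm w : chi w != 0 -> `|(chi v)%:~R : R| <= `|(chi w)%:~R|.
  by move=> /m_min; rewrite -chi_m -!intr_norm ler_int -!abszE lez_nat.
have normv : 0 < `|(chi v)%:~R : R| by rewrite normr_gt0 intr_eq0.
have ge1 : 1 <= `|r|.
  rewrite -(ler_pM2r normv) mul1r -normrM -rE; apply: min_norm.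
  by rewrite -(intr_eq0 R) rE mulf_neq0 // intr_eq0.
have le1 : `|r| <= 1.
  have rE' := rE (aut_inv_fun phi v); rewrite aut_invK in rE'.
  rewrite -(ler_pM2r normv) mul1r {2}rE' normrM ler_pM2l ?normr_gt0 //.
  apply: min_norm; rewrite -(intr_eq0 R); apply: contra_neq chiv => chi0.
  by apply/eqP; rewrite -(intr_eq0 R) rE' chi0 mulr0.
have : `|r| == 1 by rewrite eq_le le1 ge1.
by rewrite eqr_norml => /andP[/orP[]/eqP-> _]; [left|right].
Qed.

Definition character_stabilizer : set (aut V) :=
  [set phi | forall v, chi (phi v) = chi v].

Lemma character_stabilizer_subgroup : is_subgroup character_stabilizer.
Proof.
split=> [//|phi psi phiP psiP] v.
by rewrite phiP -psiP aut_invK.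
Qed.

(** There are at most two cosets: the automorphisms fixing [chi] and those
    negating it. *)
Lemma character_stabilizer_index :
  (forall phi : aut V, (forall v, chi (phi v) = chi v) \/
                       (forall v, chi (phi v) = - chi v)) ->
  finite_index character_stabilizer.
Proof.
move=> sgn.
apply: (sub_finite_set _ (finite_set2 character_stabilizer
  [set phi : aut V | forall v, chi (phi v) = - chi v])).
move=> _ [phi _ <-].
case: (sgn phi) => phiP; [left|right]; apply/seteqP; split.
- by move=> _ [psi psiP <-] v /=; rewrite phiP psiP.
- move=> psi psiP; exists (phi^-1 * psi)%g; last by rewrite mulVKg.
  by move=> v /=; rewrite -phiP aut_invK psiP.
- by move=> _ [psi psiP <-] v /=; rewrite phiP psiP.
- move=> psi psiP; exists (phi^-1 * psi)%g; last by rewrite mulVKg.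
  by move=> v /=; rewrite -[LHS]opprK -phiP aut_invK psiP opprK.
Qed.

End IntegralCharacter.

(** * Abelian groups of rank one *)

(** In a nontrivial integral relation between [b] and an element [a] of infinite
    order, the coefficient of [b] cannot vanish. *)
Lemma rank1_commensurable (A : zmodType) : torsion_free_rank_eq A 1 ->
  exists a : A, (forall n : int, a *~ n = 0 -> n = 0) /\
    forall b : A, exists2 d : int, d != 0 & exists n : int, b *~ d = a *~ n.
Proof.
move=> [[a a_free] dep]; exists (a ord0).
have a0 n : a ord0 *~ n = 0 -> n = 0.
  by move=> an; apply: (a_free (fun _ => n) _ ord0); rewrite big_ord1.
split=> // b.
have [k [ksum k_neq0]] : exists k : int * int,
    b *~ k.1 + a ord0 *~ k.2 = 0 /\ (k.1 != 0 \/ k.2 != 0).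
  apply: contrapT => nok; apply: dep.
  exists (fun i : 'I_2 => if i == ord0 then b else a ord0) => k.
  rewrite big_ord_recl big_ord1 /= => ksum i.
  apply: contrapT => /eqP ki; apply: nok.
  exists (k ord0, k (lift ord0 ord0)); split=> //=.
  case: (unliftP ord0 i) ki => [j ->|->]; last by left.
  by rewrite (ord1 j); right.
have k1 : k.1 != 0.
  case: k_neq0 => //; apply: contra_neq => k1; apply: a0.
  by move: ksum; rewrite k1 mulr0z add0r.
exists k.1 => //; exists (- k.2).
by rewrite mulrNz; apply/eqP; rewrite -addr_eq0 ksum.
Qed.

(** A common multiple of the finitely many denominators. *)
Lemma common_multiple (A : zmodType) (a : A) (bs : seq A) :
  (forall b, exists2 d : int, d != 0 & exists n : int, b *~ d = a *~ n) ->
  exists2 d : int, d != 0 &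
    forall b, b \in bs -> exists n : int, b *~ d = a *~ n.
Proof.
move=> comm; elim: bs => [|b bs [d d0 dP]]; first by exists 1.
have [c c0 [m bc]] := comm b; exists (c * d) => [|b']; first exact: mulf_neq0.
rewrite inE => /orP[/eqP->|/dP[n bn]].
  by exists (m * d); rewrite !mulrzA bc.
by exists (n * c); rewrite mulrC !mulrzA bn.
Qed.

(** The coordinate along [a], taken modulo torsion, is rational; finite
    generation bounds its denominators, so that [d] times the coordinate is
    integral.  Its values are unique, since [a] has infinite order, and this
    makes it additive. *)
Lemma integral_coordinate (V : groupType) (S : seq V) (A : zmodType)
    (f : V -> A) (a : A) :
  generates S -> {morph f : x y / (x * y)%g >-> x + y} ->
  (forall n : int, a *~ n = 0 -> n = 0) ->
  (forall b, exists2 d : int, d != 0 & exists n : int, b *~ d = a *~ n) ->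
  exists (d : int) (chi : V -> int),
    [/\ d != 0, {morph chi : x y / (x * y)%g >-> x + y} &
        forall v, f v *~ d = a *~ chi v].
Proof.
move=> gS fM a_free comm.
have [d d0 dP] := common_multiple (map f S) comm.
have /choice[chi chiE] : forall v, exists n : int, f v *~ d = a *~ n.
  apply: (generates_ind (P := fun v => exists n : int, f v *~ d = a *~ n) gS).
    split; first by exists 0; rewrite (additive1 fM) mul0rz mulr0z.
    move=> v w [m vm] [n wn]; exists (m - n).
    by rewrite fM (additiveV fM) mulrzBl vm wn mulrzBr.
  by move=> s sS; apply/dP/map_f.
exists d, chi; split=> // v w; apply/eqP; rewrite -subr_eq0; apply/eqP/a_free.
by rewrite mulrzBr mulrzDr -!chiE fM mulrzDl subrr.
Qed.

(** * The wreath product *)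

Section WreathCharacter.
Variables (R : realType) (H G : groupType) (X : choiceType) (act : gset G X).

Definition top_lift (g : G) : wreath H act := Wreath act (rp_one H X) g.

Lemma top_liftM : {morph top_lift : g h / (g * h)%g}.
Proof.
move=> g h; apply: wreath_eq => //= x.
by rewrite rp_mulE rp_actE !rp_oneE mulg1.
Qed.

Lemma wreath_factor (w : wreath H act) :
  w = (Wreath act (wbase w) 1 * top_lift (wtop w))%g.
Proof.
apply: wreath_eq => /= [x|]; last by rewrite mul1g.
by rewrite rp_mulE rp_actE rp_oneE mulg1.
Qed.

(** A character that vanishes on the base factors through [G^ab], where it is
    determined by its value at an element [a] of infinite order, because each
    element has a nonzero multiple that is a multiple of [a]. *)
Lemma wreath_rank1_character (S : seq (wreath H act)) :
  generates S -> torsion_free_rank_eq (abelianization G) 1 ->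
  exists chi : wreath H act -> int,
    [/\ {morph chi : x y / (x * y)%g >-> x + y}, exists v, chi v != 0,
        forall v, base_subgroup H act v -> chi v = 0 &
        forall psi : wreath H act -> R, is_character psi ->
          (forall v, base_subgroup H act v -> psi v = 0) ->
          exists r, forall v, psi v = r * (chi v)%:~R].
Proof.
move=> gS /rank1_commensurable[a [a_free comm]].
pose f (w : wreath H act) := ab_pi (wtop w).
have fM : {morph f : x y / (x * y)%g >-> x + y}.
  by move=> v w; rewrite /f -ab_piM.
have [d [chi [d0 chiM chiE]]] := integral_coordinate gS fM a_free comm.
exists chi; split=> //.
- exists (top_lift (ab_repr a)); apply: contra_neq d0 => chi0; apply: a_free.
  by have := chiE (top_lift (ab_repr a)); rewrite /f /= ab_reprK chi0 mulr0z.
- move=> _ [m _ <-]; apply: a_free.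
  by rewrite -chiE /f /= (additive1 (@ab_piM G)) mul0rz.
- move=> psi psiM psi0; pose psiG g := psi (top_lift g).
  have psiGM : {morph psiG : g h / (g * h)%g >-> g + h}.
    by move=> g h; rewrite /psiG top_liftM psiM.
  exists (ab_lift psiG a / d%:~R) => w.
  have -> : psi w = ab_lift psiG (f w).
    rewrite (ab_lift_pi psiGM) {1}[w]wreath_factor psiM psi0 ?add0r //.
    by exists (wbase w).
  have := congr1 (ab_lift psiG) (chiE w); rewrite !(ab_liftMz psiGM).
  rewrite -[_ *~ d]mulrzr -[_ *~ chi w]mulrzr => fwE.
  apply: (mulIf (x := d%:~R)); first by rewrite intr_eq0.
  by rewrite fwE mulrAC divfK ?intr_eq0.
Qed.

End WreathCharacter.

Theorem corollary9p5 (R : realType) (H G : groupType) (X : choiceType)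
    (act : gset G X) (S : seq (wreath H act)) :
  generates S ->
  (exists h : H, h != 1%g) ->
  [set: X] !=set0 ->
  Sigma1 R S =
    character_sphere_where
      [set chi | exists2 v, base_subgroup H act v & chi v != 0] ->
  torsion_free_rank_eq (abelianization G) 1%N ->
  exists N : set (aut (wreath H act)),
    [/\ is_subgroup N, finite_index N &
        forall phi, N phi -> reidemeister_infinite phi].
Proof.
move=> gS _ _ sigmaE rk1.
have [chi [chiM chi_neq0 chi_base chi_unique]] :=
  wreath_rank1_character R gS rk1.
pose chiR v : R := (chi v)%:~R.
have chiRM : is_character chiR by move=> v w; rewrite /chiR chiM intrD.
have chiR_nz : nonzero_character chiR.
  by split=> //; have [v chiv] := chi_neq0; exists v; rewrite intr_eq0.
have chiR_base v : base_subgroup H act v -> chiR v = 0.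
  by move=> /chi_base; rewrite /chiR => ->.
exists (character_stabilizer chi); split.
- exact: character_stabilizer_subgroup.
- apply: character_stabilizer_index => phi.
  have [|v /(character_aut_vanishes gS sigmaE phi chiR_nz chiR_base)//|r rE] :=
    chi_unique (chiR \o phi).
    by move=> v w; rewrite /= aut_morph chiRM.
  have [r1|r1] := proportional_aut_sign chi_neq0 rE; [left|right] => v.
    by apply: (@intr_inj R); rewrite [LHS]rE r1 mul1r.
  by apply: (@intr_inj R); rewrite [LHS]rE r1 mulN1r intrN.
- by move=> phi; apply: reidemeister_infinite_fixed_character.
Qed.
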